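(* Let $A$ be a (commutative) ring. If the diagram of $A$ collapses in the theory of algebraically closed fields, then $A$ is trivial. In particular: a) If $A$ is a non-trivial ring, the diagram of $A$ does not collapse in the theory of fields. b) If $K$ is a field, the diagram of $K$ does not collapse in the theory of algebraically closed fields.
   Context: Language of fields $\mathcal L_f$: constants $0,1,-1$, operations $+,\times$, and two unary relation symbols ''$=0$'' and ''$\neq0$''. Terms over a set of variables $G$ are identified with polynomials in $\mathbb Z[G]$. A presentation $(G;R_{=0},R_{\neq0})$ is a set $G$ of variables (generators) and two subsets of $\mathbb Z[G]$, with relations $p=0$ for $p\in R_{=0}$ and $p\neq0$ for $p\in R_{\neq0}$. The diagram of a structure has one generator $X_a$ for each element $a$ and as relations all atomic formulas true in the structure (it contains no negations of atomic formulas). For a ring $A$, the relations are the $P(X_{a_1},\dots,X_{a_r})=0$, $P$ an integer polynomial, such that $P(a_1,\dots,a_r)=0$ in $A$ (so distinctness of elements does not appear). For a field $K$, where ''$\neq0$'' is interpreted as being nonzero, there are also the relations $P(X_{a_1},\dots,X_{a_r})\neq0$ true in $K$. Theory of fields: $\vdash 0=0$; $x=0,y=0\vdash x+y=0$; $x=0\vdash xy=0$; $x=0,y\neq0\vdash x+y\neq0$; $x\neq0,y\neq0\vdash xy\neq0$; $\vdash1\neq0$; $0\neq0\vdash\bot$; $xy-1=0\vdash x\neq0$; $x\neq0\vdash\exists y\ xy-1=0$; $\vdash x=0\vee x\neq0$. Theory of algebraically closed fields: add, for each $n\ge1$, $\vdash\exists y\ y^n+x_{n-1}y^{n-1}+\cdots+x_1y+x_0=0$.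 Covering: a covering of a presentation $(G;R)$ in a theory given by such axioms (each of the form $H(\mathbf x)\vdash\exists\mathbf y_1A_1(\mathbf x,\mathbf y_1)\vee\cdots\vee\exists\mathbf y_kA_k(\mathbf x,\mathbf y_k)$ with $H,A_i$ conjunctions of atomic formulas, $k\ge0$, the case $k=0$ being written $\bot$) is a finite tree whose nodes $n$ carry presentations $(G_n;R_n)$. At the root one has $(G;R)$ plus finitely many consequences of $R$ under the algebraic axioms (those with a single atomic formula and no $\exists$ on the right). At a node $n$, if $\mathbf t$ is a list of terms over $G_n$ and all conjuncts of $H(\mathbf t)$ are in $R_n$, one may create $k$ children, the $i$-th with generators $G_n\cup\{\mathbf z_i\}$ ($\mathbf z_i$ new variables) and relations $R_n\cup\{A_i(\mathbf t,\mathbf z_i)\}$ plus finitely many consequences under algebraic axioms. A branch ended by an application of an axiom with $k=0$ is dead. $(G;R)$ collapses if it has a covering all of whose branches are dead. *)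

(* Defs.v *)
From HB Require Import structures.
From mathcomp Require Import all_boot all_order all_algebra.
From mathcomp Require Import finmap.
From mathcomp.multinomials Require Import monalg.

Set Implicit Arguments.
Unset Strict Implicit.
Unset Printing Implicit Defensive.

Import GRing.Theory.
Local Open Scope ring_scope.

(* Terms in the language of fields, identified with polynomials in Z[G]; the
   set of variables G may be infinite.  [var] and [eval] are locked because
   comparing two polynomials by conversion can run for very long. *)
Definition term (G : choiceType) := {malg int[{cmonom G}]}.

HB.lock Definition var (G : choiceType) (x : G) : term G := << ucm x >>.

(* [mmap] is only available when the target ring satisfies 1 != 0, and A may
   be the zero ring here, so evaluation is written out. *)
HB.lock Definition eval (G : choiceType) (S : comPzRingType) (v : G -> S)
    (p : term G) : S :=
  \sum_(m <- msupp p) (\prod_(x <- finsupp m) v x ^+ m x) *~ p@_m.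

Inductive atom (G : choiceType) :=
| EqZ of term G
| NeqZ of term G.

Definition atom_code (G : choiceType) (f : atom G) : term G + term G :=
  match f with EqZ p => inl p | NeqZ p => inr p end.

Definition atom_decode (G : choiceType) (c : term G + term G) : atom G :=
  match c with inl p => EqZ p | inr p => NeqZ p end.

Lemma atom_codeK (G : choiceType) : cancel (@atom_code G) (@atom_decode G).
Proof. by case. Qed.

HB.instance Definition _ (G : choiceType) :=
  Equality.copy (atom G) (can_type (@atom_codeK G)).

Definition subst (G H : choiceType) (s : G -> term H) (f : atom G) : atom H :=
  match f with
  | EqZ p => EqZ (eval s p)
  | NeqZ p => NeqZ (eval s p)
  end.

(* A rule H(x) |- (exists y_1, A_1(x, y_1)) \/ ... \/ (exists y_k, A_k(x, y_k)):
   the variables x are indexed by 'I_(nvars r) and, in each disjunct, are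
   injected by [inl], the y_i being injected by [inr]. *)
Record disjunct (n : nat) := Disjunct {
  nex : nat;
  conjuncts : seq (atom ('I_n + 'I_nex)%type)
}.

Record rule := Rule {
  nvars : nat;
  hyps : seq (atom 'I_nvars);
  concls : seq (disjunct nvars)
}.

Definition theory := rule -> Prop.

(* The subsets R_{=0} and R_{<>0} of Z[G] are packed as one set of atoms. *)
Record presentation := Presentation {
  gens : choiceType;
  rels : atom gens -> Prop
}.

Definition hyps_hold (G : choiceType) (R : atom G -> Prop) (r : rule)
    (t : 'I_(nvars r) -> term G) : Prop :=
  forall h, h \in hyps r -> R (subst t h).

Definition inst (n m : nat) (H : choiceType) (t : 'I_n -> term H)
    (z : 'I_m -> term H) (v : 'I_n + 'I_m) : term H :=
  match v with inl i => t i | inr j => z j end.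

(* Closure under the algebraic rules, i.e. those whose right-hand side is a
   single atom without existential variable. *)
Inductive consequence (T : theory) (P : presentation) : atom (gens P) -> Prop :=
| ConseqRel f : rels f -> consequence T f
| ConseqRule (r : rule) (a : atom ('I_(nvars r) + 'I_0)%type)
    (t : 'I_(nvars r) -> term (gens P)) (z : 'I_0 -> term (gens P)) :
    T r -> concls r = [:: Disjunct [:: a]] ->
    hyps_hold (@consequence T P) t ->
    consequence T (subst (inst t z) a).

Definition extend (P : presentation) (s : seq (atom (gens P))) : presentation :=
  Presentation (fun f => rels f \/ f \in s).

Definition old_term (G : choiceType) (m : nat) :
    term G -> term (G + 'I_m)%type :=
  eval (fun x => var (inl x)).

Definition old_atom (G : choiceType) (m : nat) :
    atom G -> atom (G + 'I_m)%type :=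
  subst (fun x => var (inl x)).

(* The i-th child adds to the generators nex d new variables z, which are
   substituted for the existential variables of the disjunct d. *)
Definition child (P : presentation) (n : nat) (t : 'I_n -> term (gens P))
    (d : disjunct n) : presentation :=
  Presentation (gens := (gens P + 'I_(nex d))%type) (fun f =>
    (exists2 g, rels g & f = old_atom (nex d) g) \/
    f \in [seq subst (inst (fun i => old_term (nex d) (t i))
                           (fun j => var (inr j))) a | a <- conjuncts d]).

(* In both constructors, s lists the finitely many consequences under the
   algebraic rules that are added to the presentation at the current node. *)
Inductive covering (T : theory) (P : presentation) : Type :=
| Leaf (s : seq (atom (gens P))) of
    (forall f, f \in s -> consequence T f)
| Branch (s : seq (atom (gens P))) (r : rule)
    (t : 'I_(nvars r) -> term (gens (extend s))) of
    (forall f, f \in s -> consequence T f) &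
    T r &
    hyps_hold (@rels (extend s)) t &
    (forall i : 'I_(size (concls r)),
       covering T (child t (tnth (in_tuple (concls r)) i))).

(* A [Branch] on a rule with no disjunct ends a dead branch. *)
Fixpoint all_dead (T : theory) (P : presentation) (c : covering T P) : Prop :=
  match c with
  | Leaf _ _ => False
  | Branch _ _ _ _ _ _ children => forall i, all_dead (children i)
  end.

Definition collapses (P : presentation) (T : theory) : Prop :=
  exists c : covering T P, all_dead c.

Definition just (n : nat) (a : atom ('I_n + 'I_0)%type) : seq (disjunct n) :=
  [:: Disjunct [:: a]].

Local Notation x_ := (var (ord0 : 'I_2)).
Local Notation y_ := (var (ord_max : 'I_2)).
Local Notation x'_ := (var (inl (ord0 : 'I_2))).
Local Notation y'_ := (var (inl (ord_max : 'I_2))).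
Local Notation u_ := (var (ord0 : 'I_1)).
Local Notation u'_ := (var (inl (ord0 : 'I_1))).
Local Notation ex_ := (var (inr (ord0 : 'I_1))).

Inductive field_theory : theory :=
| F_zero : field_theory (@Rule 0 [::] (just (EqZ 0)))
| F_add0 : field_theory
    (@Rule 2 [:: EqZ x_; EqZ y_] (just (EqZ (x'_ + y'_))))
| F_mul0 : field_theory (@Rule 2 [:: EqZ x_] (just (EqZ (x'_ * y'_))))
| F_addN : field_theory
    (@Rule 2 [:: EqZ x_; NeqZ y_] (just (NeqZ (x'_ + y'_))))
| F_mulN : field_theory
    (@Rule 2 [:: NeqZ x_; NeqZ y_] (just (NeqZ (x'_ * y'_))))
| F_one : field_theory (@Rule 0 [::] (just (NeqZ 1)))
| F_bot : field_theory (@Rule 0 [:: NeqZ 0] [::])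
| F_unit : field_theory
    (@Rule 2 [:: EqZ (x_ * y_ - 1)] (just (NeqZ x'_)))
| F_inv : field_theory
    (@Rule 1 [:: NeqZ u_] [:: @Disjunct 1 1 [:: EqZ (u'_ * ex_ - 1)]])
| F_dec : field_theory
    (@Rule 1 [::] [:: @Disjunct 1 0 [:: EqZ u'_]; @Disjunct 1 0 [:: NeqZ u'_]]).

Definition root_rule (n : nat) : rule :=
  @Rule n [::] [:: @Disjunct n 1
    [:: EqZ (ex_ ^+ n + \sum_(i < n) var (inl i) * ex_ ^+ i)]].

Inductive acf_theory : theory :=
| ACF_field r : field_theory r -> acf_theory r
| ACF_root n : (0 < n)%N -> acf_theory (root_rule n).

(* Generator X_a for each a in A; a term P(X_{a_1}, ..., X_{a_r}) is evaluated
   at X_a := a. *)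
Definition ring_diagram (A : comPzRingType) : presentation :=
  Presentation (gens := A) (fun f =>
    match f with
    | EqZ p => eval id p = 0
    | NeqZ _ => False
    end).

Definition field_diagram (K : fieldType) : presentation :=
  Presentation (gens := K) (fun f =>
    match f with
    | EqZ p => eval id p = 0
    | NeqZ p => eval id p <> 0
    end).

Definition trivial_ring (A : comPzRingType) : Prop := forall a : A, a = 0.

(* Main.v *)
From HB Require Import structures.
Require Import Defs.
From mathcomp Require Import all_boot all_order all_algebra.
From mathcomp Require Import boolp.
From mathcomp Require Import finmap.
From mathcomp.multinomials Require Import monalg.

Set Implicit Arguments.
Unset Strict Implicit.
Unset Printing Implicit Defensive.

Import GRing.Theory.
Local Open Scope ring_scope.

(** A presentation is read semantically: a model of it is a commutative ring
    in which 1 <> 0, with a value for each generator, such that every p with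
    p = 0 among the relations evaluates to 0 and every p with p <> 0 among them
    evaluates to a unit. Interpreting p <> 0 as being a unit, rather than as not
    being zero, is what lets the models be arbitrary nonzero rings: the axioms
    with a single atomic conclusion and the existence of inverses then hold in
    every such ring, and 0 <> 0 fails in it because 0 is not a unit.

    The other two kinds of axioms hold up to replacing the ring S by an
    S-algebra which is still nonzero. For x = 0 \/ x <> 0: if the value a of x
    is a unit, S itself will do, and otherwise S/(a) is nonzero and makes x
    vanish. For the existence of a root of a monic polynomial p of positive
    degree: S[X]/(p) is nonzero, since p is monic of positive degree and thus
    not a unit of S[X]. Both are quotients by a nonunit
    ([principal_quotient]), and [rule_sound] collects these facts. Morphisms
    preserve zeros and units, so the relations already present stay true.

    Hence a model of the presentation at a node yields a model of one of its
    children ([dead_no_model]); a presentation with a model therefore has no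
    covering with only dead branches. A nonzero ring A is a model of its
    diagram, and a field is a model of its diagram because its nonzero elements
    are units. *)

(** * Evaluation of terms *)

Lemma rmorph_eval (G : choiceType) (S S' : comPzRingType)
    (f : {rmorphism S -> S'}) (v : G -> S) (p : term G) :
  f (eval v p) = eval (f \o v) p.
Proof.
rewrite eval.unlock rmorph_sum; apply: eq_bigr => m _.
rewrite rmorphMz rmorph_prod; congr (_ *~ _); apply: eq_bigr => x _.
by rewrite rmorphXn.
Qed.

Lemma eq_eval (G : choiceType) (S : comPzRingType) (v w : G -> S) :
  v =1 w -> eval v =1 eval w.
Proof. by move=> /funext ->. Qed.

(** The products in the definition of [eval] are named so that [eval] can be
    recognised as an instance of [mmap] and inherit its morphism properties. *)
Definition monom_eval (G : choiceType) (S : comNzRingType) (v : G -> S)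
    (m : {cmonom G}) : S :=
  \prod_(x <- finsupp m) v x ^+ m x.

(** Extra variables have exponent 0; this allows two monomials to be evaluated
    over one common support. *)
Lemma monom_evalEw (G : choiceType) (S : comNzRingType) (v : G -> S)
    (d : {fset G}) (m : {cmonom G}) :
  (finsupp m `<=` d)%fset -> monom_eval v m = \prod_(x <- d) v x ^+ m x.
Proof.
move=> le; rewrite /monom_eval (big_fset_incl _ le) // => x _.
by rewrite -cmE_neq0 negbK => /eqP ->; rewrite expr0.
Qed.

Lemma monom_eval_multiplicative (G : choiceType) (S : comNzRingType)
    (v : G -> S) : mmorphism (monom_eval v).
Proof.
split=> [m1 m2|]; last by rewrite /monom_eval mdom1 big_seq_fset0.
rewrite (monom_evalEw v (fsubsetUl (finsupp m1) (finsupp m2)))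
        (monom_evalEw v (fsubsetUr (finsupp m1) (finsupp m2))).
rewrite /monom_eval mdomD -big_split /=.
by apply: eq_bigr => x _; rewrite cmM exprD.
Qed.

HB.instance Definition _ (G : choiceType) (S : comNzRingType) (v : G -> S) :=
  monalg.isMultiplicative.Build {cmonom G} S (monom_eval v)
    (monom_eval_multiplicative v).

Lemma evalE (G : choiceType) (S : comNzRingType) (v : G -> S) (p : term G) :
  eval v p = mmap (intr : int -> S) (monom_eval v) p.
Proof.
by rewrite eval.unlock; apply: eq_bigr => m _; rewrite mulrzl.
Qed.

Lemma eval_zmod_morphism (G : choiceType) (S : comNzRingType) (v : G -> S) :
  zmod_morphism (eval v).
Proof. by move=> p q; rewrite !evalE; exact: rmorphB. Qed.

Lemma eval_monoid_morphism (G : choiceType) (S : comNzRingType) (v : G -> S) :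
  monoid_morphism (eval v).
Proof.
have [mulP oneP] :=
  @mmap_is_multiplicative {cmonom G} int S intr (monom_eval v).
split=> [|p q]; rewrite !evalE; [exact: oneP | exact: mulP].
Qed.

HB.instance Definition _ (G : choiceType) (S : comNzRingType) (v : G -> S) :=
  GRing.isZmodMorphism.Build (term G) S (eval v) (eval_zmod_morphism v).
HB.instance Definition _ (G : choiceType) (S : comNzRingType) (v : G -> S) :=
  GRing.isMonoidMorphism.Build (term G) S (eval v) (eval_monoid_morphism v).

Lemma eval_var (G : choiceType) (S : comNzRingType) (v : G -> S) (x : G) :
  eval v (var x) = v x.
Proof.
rewrite evalE var.unlock mmapU /= mulr1z mul1r /monom_eval mdomU.
by rewrite big_seq_fset1 cmUU.
Qed.

(** Composition of substitutions: evaluation is itself a morphism, so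
    this is naturality of [eval]. *)
Lemma eval_eval (G H : choiceType) (S : comNzRingType) (v : H -> S)
    (s : G -> term H) (p : term G) :
  eval v (eval s p) = eval (eval v \o s) p.
Proof. exact: rmorph_eval. Qed.

(** * Models *)

(** The relation p <> 0 is read as invertibility, which, unlike being
    nonzero, is preserved by morphisms. *)
Definition holds (G : choiceType) (S : comPzRingType) (v : G -> S)
    (f : atom G) : Prop :=
  match f with
  | EqZ p => eval v p = 0
  | NeqZ p => exists y, eval v p * y = 1
  end.

Lemma eq_holds (G : choiceType) (S : comPzRingType) (v w : G -> S) f :
  v =1 w -> holds v f -> holds w f.
Proof. by move=> /funext ->. Qed.

Lemma holds_rmorph (G : choiceType) (S S' : comPzRingType)
    (g : {rmorphism S -> S'}) (v : G -> S) (f : atom G) :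
  holds v f -> holds (g \o v) f.
Proof.
case: f => p /=; first by rewrite -rmorph_eval => ->; rewrite rmorph0.
by case=> y e; exists (g y); rewrite -rmorph_eval -rmorphM e rmorph1.
Qed.

Lemma holds_subst (G H : choiceType) (S : comNzRingType) (v : H -> S)
    (s : G -> term H) (f : atom G) :
  holds v (subst s f) <-> holds (eval v \o s) f.
Proof. by case: f => p /=; rewrite eval_eval. Qed.

Definition join (G H S : Type) (v : G -> S) (z : H -> S) (x : G + H) : S :=
  match x with inl a => v a | inr b => z b end.

Definition disjunct_holds (n : nat) (S : comPzRingType) (w : 'I_n -> S)
    (d : disjunct n) : Prop :=
  exists z : 'I_(nex d) -> S,
    forall a, a \in conjuncts d -> holds (join w z) a.

Definition hyps_true (r : rule) (S : comPzRingType) (w : 'I_(nvars r) -> S) :=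
  forall h, h \in hyps r -> holds w h.

(** * Nonzero quotients *)

(** The ideal of a nonunit is proper, so the quotient by it is again a ring
    with 1 <> 0. Excluded middle makes membership a boolean predicate. *)
Lemma principal_quotient (R : comNzRingType) (a : R) :
  (forall b, a * b <> 1) ->
  exists (S : comNzRingType) (f : {rmorphism R -> S}), f a = 0.
Proof.
move=> a_nonunit.
pose I : R -> bool := fun x => `[< exists b, x = a * b >].
have I_closed : idealr_closed I.
  split=> [||b x y].
  - by apply/asboolP; exists 0; rewrite mulr0.
  - by apply/negP => /asboolP[b /esym]; apply: a_nonunit.
  - move=> /asboolP[c ->] /asboolP[d ->]; apply/asboolP.
    by exists (b * c + d); rewrite mulrDr mulrCA.
pose J : idealr R := HB.pack I (isIdealr.Build R I I_closed).
pose pr : {rmorphism R -> {ideal_quot J}} := \pi_({ideal_quot J})%qT.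
exists {ideal_quot J}, pr; apply/eqP; rewrite -(rmorph0 pr).
rewrite -Quotient.idealrBE subr0; apply/asboolP.
by exists 1; rewrite mulr1.
Qed.

(** The ring S is R[X]/(p) for p monic of degree n. If p b = 1, then comparing
    degrees, which add up because p is monic, forces n = 0. *)
Lemma adjoin_root (R : comNzRingType) (n : nat) (w : 'I_n -> R) :
  (0 < n)%N ->
  exists (S : comNzRingType) (f : {rmorphism R -> S}) (z : S),
    z ^+ n + \sum_(i < n) f (w i) * z ^+ i = 0.
Proof.
move=> n_gt0; pose q : {poly R} := \sum_(i < n) (w i)%:P * 'X^i.
have size_q : (size q < size ('X^n : {poly R}))%N.
  rewrite size_polyXn ltnS; apply: leq_trans (size_sum _ _ _) _.
  apply/bigmax_leqP => i _; rewrite mul_polyC.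
  by apply: leq_trans (size_scale_leq _ _) _; rewrite size_polyXn.
have p_monic : 'X^n + q \is monic by rewrite monicE lead_coefDl // lead_coefXn.
have size_p : size ('X^n + q) = n.+1 by rewrite size_polyDl // size_polyXn.
have [b e | S [f fp0]] := @principal_quotient {poly R} ('X^n + q).
  have b_neq0 : b != 0.
    by apply: contra_eq_neq e => ->; rewrite mulr0 eq_sym oner_eq0.
  have := congr1 (fun s : {poly R} => size s) e.
  rewrite mulrC size_Mmonic // size_p size_poly1 addnS /= => /eqP.
  case: (size b) (size_poly_eq0 b) => [|k _].
    by rewrite eqxx (negPf b_neq0).
  by rewrite addSn eqSS addn_eq0 [n == 0%N]eqn0Ngt n_gt0 andbF.
exists S, (f \o polyC), (f 'X).
apply: etrans fp0; rewrite rmorphD rmorphXn [in RHS]rmorph_sum; congr (_ + _).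
by apply: eq_bigr => i _; rewrite rmorphM rmorphXn.
Qed.

(** * Soundness *)

Lemma disjunct_holds1 (n : nat) (S : comPzRingType) (w : 'I_n -> S)
    (a : atom ('I_n + 'I_0)%type) :
  holds (join w (fun=> 0)) a -> disjunct_holds w (Disjunct [:: a]).
Proof. by move=> ha; exists (fun=> 0) => b /=; rewrite inE => /eqP ->. Qed.

(** These are the only rules that also serve to form consequences at a fixed
    node, and for this they have to hold in S itself, not merely after an
    extension of S. *)
Lemma algebraic_rule_sound (r : rule) (d : disjunct (nvars r)) :
  acf_theory r -> concls r = [:: d] -> nex d = 0%N ->
  forall (S : comNzRingType) (w : 'I_(nvars r) -> S),
  hyps_true w -> disjunct_holds w d.
Proof.
move=> r_acf; case: r_acf d => [_ [] | n _] d //= [<-] //= _ S w hw;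
  apply: disjunct_holds1 => /=.
- exact: rmorph0.
- have /= := hw _ (mem_head _ _); have /= := hw _ (mem_last _ _).
  by rewrite rmorphD /= !eval_var /= => -> ->; rewrite addr0.
- have /= := hw _ (mem_head _ _).
  by rewrite rmorphM /= !eval_var /= => ->; rewrite mul0r.
- have /= := hw _ (mem_head _ _); have /= := hw _ (mem_last _ _).
  by rewrite rmorphD /= !eval_var /= => -[y e] ->; exists y; rewrite add0r.
- have /= := hw _ (mem_head _ _); have /= := hw _ (mem_last _ _).
  rewrite rmorphM /= !eval_var /= => -[y ey] [x ex].
  by exists (x * y); rewrite mulrACA ex ey mulr1.
- by exists 1; rewrite rmorph1 mulr1.
- have /= := hw _ (mem_head _ _).
  rewrite rmorphB rmorphM rmorph1 /= !eval_var => /eqP; rewrite subr_eq0 => /eqP e.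
  by eexists; exact: e.
Qed.

(** The extension S' differs from S for two rules only: the case distinction
    x = 0 \/ x <> 0 may need S' = S/(x), and root existence S' = S[X]/(p). *)
Lemma rule_sound (r : rule) :
  acf_theory r ->
  forall (S : comNzRingType) (w : 'I_(nvars r) -> S), hyps_true w ->
  exists (i : 'I_(size (concls r))) (S' : comNzRingType)
    (f : {rmorphism S -> S'}),
    disjunct_holds (f \o w) (tnth (in_tuple (concls r)) i).
Proof.
move=> r_acf S w hw.
have algebraic d : concls r = [:: d] -> nex d = 0%N ->
    exists (i : 'I_(size (concls r))) (S' : comNzRingType)
      (f : {rmorphism S -> S'}),
      disjunct_holds (f \o w) (tnth (in_tuple (concls r)) i).
  move=> er d0; have hd := algebraic_rule_sound r_acf er d0 hw.
  have i0 : (0 < size (concls r))%N by rewrite er.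
  exists (Ordinal i0), S, idfun; rewrite (tnth_nth d) /= er; exact: hd.
case: r_acf w hw algebraic => [_ [] | n n_gt0] w hw /= algebraic;
  try exact: algebraic.
- have [y /eqP] := hw _ (mem_head _ _).
  by rewrite rmorph0 mul0r eq_sym oner_eq0.
- have [y ey] := hw _ (mem_head _ _).
  exists ord0, S, idfun, (fun=> y) => a; rewrite inE => /eqP -> /=.
  rewrite rmorphB rmorphM rmorph1 /= !eval_var /=.
  by move: ey; rewrite eval_var => ->; rewrite subrr.
(* A unit already satisfies the second disjunct; a nonunit can be killed. *)
- have [[y ey] | nonunit] := pselect (exists y, w ord0 * y = 1).
    exists ord_max, S, idfun; apply: disjunct_holds1; exists y.
    by rewrite eval_var.
  have [y ey | S' [f fw0]] := @principal_quotient S (w ord0).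
    by apply: nonunit; exists y.
  by exists ord0, S', f; apply: disjunct_holds1; rewrite /= eval_var.
- have [S' [f [z ez]]] := adjoin_root w n_gt0.
  exists ord0, S', f, (fun=> z) => a; rewrite inE => /eqP -> /=.
  rewrite rmorphD rmorphXn rmorph_sum /= !eval_var -[RHS]ez; congr (_ + _).
  by apply: eq_bigr => i _; rewrite rmorphM rmorphXn /= !eval_var.
Qed.

Lemma consequence_sound (T : theory) (P : presentation) (S : comNzRingType)
    (v : gens P -> S) :
  (forall r, T r -> acf_theory r) ->
  (forall f, rels f -> holds v f) ->
  forall f, consequence T f -> holds v f.
Proof.
move=> T_acf Pv; fix IH 2 => f; case=> [{}f /Pv //|r a t z Tr er ht].
rewrite holds_subst.
have [|z' /(_ a)] :=
  algebraic_rule_sound (T_acf _ Tr) er erefl (w := eval v \o t).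
  by move=> h /ht /IH; rewrite holds_subst.
by rewrite inE eqxx => /(_ isT); apply: eq_holds => -[|[]].
Qed.

(** The ring has to be quantified after the covering: going down a branch
    replaces it by an algebra over it. At a dead end no child remains to carry
    the model. *)
Lemma dead_no_model (T : theory) (P : presentation) (c : covering T P) :
  (forall r, T r -> acf_theory r) -> all_dead c ->
  forall (S : comNzRingType) (v : gens P -> S),
    ~ (forall f, rels f -> holds v f).
Proof.
move=> T_acf.
elim: c => {P} [//|P s r t s_conseq Tr ht children IH] /= dead S v Pv.
have Pv' (f : atom (gens P)) : rels f \/ f \in s -> holds v f.
  by case=> [/Pv //|/s_conseq]; apply: consequence_sound.
have [|i [S' [f [z zP]]]] := rule_sound (T_acf _ Tr) (w := eval v \o t).
  by move=> h /ht /Pv'; rewrite holds_subst.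
apply: (IH i (dead i) S' (join (f \o v) z)) => g /= [[g' Pg' ->]|].
  rewrite holds_subst; apply: eq_holds (holds_rmorph f (Pv' _ Pg')) => x /=.
  by rewrite eval_var.
move=> /mapP[a /zP za ->]; rewrite holds_subst; apply: eq_holds za => -[x|y] /=.
  rewrite eval_eval rmorph_eval; apply: eq_eval => x' /=.
  by rewrite eval_var.
by rewrite eval_var.
Qed.

(** The morphism is the identity of A; only the type of the target changes,
    from a ring where 1 = 0 is possible to one where it is excluded. *)
Lemma nontrivial_rmorph (A : comPzRingType) :
  ~ trivial_ring A -> exists (S : comNzRingType), inhabited {rmorphism A -> S}.
Proof.
move=> A_nontriv.
have A10 : (1 : A) != 0.
  by apply/eqP => e; apply: A_nontriv => a; rewrite -[a]mulr1 e mulr0.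
pose S : comNzRingType :=
  HB.pack (A : Type) A (GRing.PzSemiRing_isNonZero.Build A A10).
by exists S; split; exact: (idfun : {rmorphism A -> A}).
Qed.

Lemma ring_diagram_collapse (A : comPzRingType) (T : theory) :
  (forall r, T r -> acf_theory r) ->
  collapses (ring_diagram A) T -> trivial_ring A.
Proof.
move=> T_acf [c c_dead]; apply: contrapT => /nontrivial_rmorph[S [f]].
apply: (dead_no_model T_acf c_dead (S := S) (v := f)) => -[p|p] //= p0.
by rewrite -[LHS](rmorph_eval f id) p0 rmorph0.
Qed.

Theorem corollary2p8 :
  (forall A : comPzRingType,
     collapses (ring_diagram A) acf_theory -> trivial_ring A) /\
  (forall A : comPzRingType,
     ~ trivial_ring A -> ~ collapses (ring_diagram A) field_theory) /\
  (forall K : fieldType, ~ collapses (field_diagram K) acf_theory).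
Proof.
split; first by move=> A; apply: ring_diagram_collapse.
split=> [A A_nontriv|K [c c_dead]].
  by move=> /(ring_diagram_collapse ACF_field).
apply: (dead_no_model _ c_dead (v := (id : K -> K))) => // -[p|p] //= /eqP p0.
by exists (eval id p)^-1; rewrite mulfV.
Qed.
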